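(* Let $f:\mathbb{R}^2\to\mathbb{R}$, $f(x,y)=x^4+y^5+y^4x$, and let $X$ be the zero set of $f$, with $C^\infty$-structure given by $C^\infty(\mathbb{R}^2)/(f)$. The classical de Rham cohomology of $X$ is not isomorphic to its singular cohomology.
   Context: The classical (non-derived) de Rham complex $\Omega^\bullet_X$ of $X$ is the complex of sheaves on $X$ given by the quotient $\Omega^\bullet_{\mathbb{R}^2}/\mathcal{K}^\bullet$ restricted to $X$, where $\Omega^\bullet_{\mathbb{R}^2}$ is the usual complex of smooth differential forms on $\mathbb{R}^2$ and $\mathcal{K}^\bullet$ is the differential ideal generated by $f$ and $df$: $\mathcal{K}^0=\mathcal{I}=(f)$, and $\mathcal{K}^k$ is the submodule of $k$-forms that can be written as $\sum_i f_i\alpha_i+\sum_j dg_j\wedge\beta_j$ with $f_i,g_j\in\mathcal{I}$, $\alpha_i$ $k$-forms and $\beta_j$ $(k-1)$-forms. Equivalently it is the complex of exterior powers of $C^\infty$-Kähler differentials of $C^\infty(\mathbb{R}^2)/(f)$. The classical de Rham cohomology of $X$ is the cohomology of this complex; singular cohomology is taken with real coefficients on the topological space $X\subseteq\mathbb{R}^2$. *)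

(* Defs.v *)
From HB Require Import structures.
From mathcomp Require Import all_boot all_order all_algebra.
From mathcomp Require Import all_classical all_reals all_analysis.
From mathcomp Require Import zify.

Set Implicit Arguments.
Unset Strict Implicit.
Unset Printing Implicit Defensive.

Import Order.TTheory GRing.Theory Num.Theory.
Import numFieldNormedType.Exports.

Local Open Scope classical_set_scope.
Local Open Scope ring_scope.

(* [{quot U}] from [ring_quotient] is only a Z-module; scalars are added
   here. *)
Section QuotientModule.
Local Open Scope quotient_scope.
Variables (K : nzRingType) (V : lmodType K) (U : submodClosed V).

(* [submodClosed] does not carry closure under opposite, which [Quotient.quot]
   needs; it follows from closure under scaling by -1. *)
Definition carrier : {pred V} := fun x => x \in U.

Fact carrier_submod : submod_closed carrier.
Proof.
split=> [|a x y hx hy]; first exact: rpred0.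
by apply: rpredD => //; exact: rpredZ.
Qed.

HB.instance Definition _ := GRing.isSubmodClosed.Build K V carrier
  (GRing.submod_closed_semi carrier_submod).

Definition qmod : Type := Quotient.quot carrier.

HB.instance Definition _ := GRing.Zmodule.on qmod.

Definition qproj (x : V) : qmod := \pi_(Quotient.quot carrier) x.
Definition qrepr (x : qmod) : V := repr (x : Quotient.quot carrier).

Lemma qreprK : cancel qrepr qproj.
Proof. exact: reprK. Qed.

Lemma qprojP x y : reflect (qproj x = qproj y) (x - y \in U).
Proof.
apply: (iffP idP) => [h|/eqP].
  by apply/eqP; move: h; rewrite (Quotient.idealrBE carrier x y).
by rewrite -(Quotient.idealrBE carrier x y).
Qed.

Lemma qprojB : {morph qproj : x y / x - y}.
Proof. by move=> x y; rewrite /qproj !piE. Qed.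

Lemma qprojD : {morph qproj : x y / x + y}.
Proof. by move=> x y; rewrite /qproj !piE. Qed.

Definition qscale (a : K) (x : qmod) : qmod := qproj (a *: qrepr x).

Lemma qproj_scale a x : qproj (a *: x) = qscale a (qproj x).
Proof.
apply/qprojP; rewrite -scalerBr rpredZ//; apply/qprojP.
by rewrite qreprK.
Qed.

Fact qscaleA a b x : qscale a (qscale b x) = qscale (a * b) x.
Proof. by rewrite -[x]qreprK -!qproj_scale scalerA. Qed.

Fact qscale1 : left_id 1 qscale.
Proof. by move=> x; rewrite -[x]qreprK -qproj_scale scale1r. Qed.

Fact qscaleDr : right_distributive qscale +%R.
Proof.
move=> a x y; rewrite -[x]qreprK -[y]qreprK -qprojD -!qproj_scale.
by rewrite scalerDr qprojD.
Qed.

Fact qscaleDl x : {morph qscale^~ x : a b / a + b}.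
Proof.
move=> a b; rewrite -[x]qreprK -!qproj_scale.
by rewrite scalerDl qprojD.
Qed.

HB.instance Definition _ :=
  GRing.Zmodule_isLmodule.Build K qmod qscaleA qscale1 qscaleDr qscaleDl.

Fact qproj_is_linear : linear qproj.
Proof. by move=> a x y; rewrite qprojD qproj_scale. Qed.

HB.instance Definition _ :=
  GRing.isLinear.Build K V qmod _ qproj qproj_is_linear.

End QuotientModule.

Section QuotientMap.
Variables (K : nzRingType) (V W : lmodType K).
Variables (U : submodClosed V) (T : submodClosed W) (f : {linear V -> W}).
Hypothesis fUT : forall x, x \in U -> f x \in T.

Definition qmap of (forall x, x \in U -> f x \in T) :=
  fun x : qmod U => qproj T (f (qrepr x)).

Lemma qmapE x : qmap fUT (qproj U x) = qproj T (f x).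
Proof.
apply/qprojP; rewrite -linearB; apply: fUT; apply/qprojP.
by rewrite qreprK.
Qed.

Fact qmap_is_linear : linear (qmap fUT).
Proof.
move=> a x y; rewrite -[x]qreprK -[y]qreprK -linearP !qmapE.
by rewrite !linearP.
Qed.

HB.instance Definition _ :=
  GRing.isLinear.Build K (qmod U) (qmod T) _ (qmap fUT) qmap_is_linear.

End QuotientMap.

Record cochain_complex (K : nzRingType) := CochainComplex {
  cochain :> nat -> lmodType K;
  codiff : forall k, {linear cochain k -> cochain k.+1};
  codiffK : forall k x, codiff k.+1 (codiff k x) = 0 }.

Section Cohomology.
Variables (K : nzRingType) (C : cochain_complex K) (k : nat).

Definition is_cocycle : {pred C k} := [pred x | codiff C k x == 0].

Fact is_cocycle_submod : submod_closed is_cocycle.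
Proof.
split=> [|a x y]; rewrite !inE ?linear0// => /eqP hx /eqP hy.
by rewrite linearP hx hy scaler0 addr0.
Qed.

HB.instance Definition _ :=
  GRing.isSubmodClosed.Build K (C k) is_cocycle
    (GRing.submod_closed_semi is_cocycle_submod).

Definition cocycle : Type := {x : C k | x \in is_cocycle}.

HB.instance Definition _ := SubChoice.on cocycle.
HB.instance Definition _ := [SubChoice_isSubLmodule of cocycle by <:].

(* The cochain entering degree 0 comes from the zero module. *)
Definition coboundary : set (C k) :=
  match k return set (C k) with
  | 0 => [set 0]
  | j.+1 => range (codiff C j)
  end.

Fact coboundary0 : coboundary 0.
Proof. by rewrite /coboundary; case: (k) => //= j; exists 0; rewrite ?linear0. Qed.

Fact coboundaryP a (u v : C k) :
  coboundary u -> coboundary v -> coboundary (a *: u + v).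
Proof.
rewrite /coboundary; case: (k) u v => [|j] /= u v.
  by move=> -> ->; rewrite scaler0 addr0.
by case=> s _ <- [t _ <-]; exists (a *: s + t) => //; rewrite linearP.
Qed.

Definition is_coboundary : {pred cocycle} :=
  [pred z | `[< coboundary (val z) >]].

Fact is_coboundary_submod : submod_closed is_coboundary.
Proof.
split=> [|a x y /asboolP hx /asboolP hy]; apply/asboolP.
  exact: coboundary0.
by rewrite linearP; exact: coboundaryP.
Qed.

HB.instance Definition _ :=
  GRing.isSubmodClosed.Build K cocycle is_coboundary
    (GRing.submod_closed_semi is_coboundary_submod).

Definition cohomology : lmodType K := qmod is_coboundary.

End Cohomology.

Definition lmod_isomorphic (K : nzRingType) (V W : lmodType K) : Prop :=
  exists f : {linear V -> W}, bijective f.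

Section Smooth.
Variable R : realType.
Implicit Types (f g : R * R -> R) (p : R * R) (n : nat).

Definition pderivx g p : R := derive1 (fun t => g (t, p.2)) p.1.
Definition pderivy g p : R := derive1 (fun t => g (p.1, t)) p.2.

Definition pderivable g : Prop := forall p,
  derivable (fun t => g (t, p.2)) p.1 1 /\ derivable (fun t => g (p.1, t)) p.2 1.

Fixpoint classC n g : Prop :=
  match n with
  | 0 => continuous g
  | m.+1 => [/\ continuous g, pderivable g,
                classC m (pderivx g) & classC m (pderivy g)]
  end.

Definition smooth g : Prop := forall n, classC n g.

Let derive1_add (u v : R -> R) x : derivable u x 1 -> derivable v x 1 ->
  derive1 (u + v) x = derive1 u x + derive1 v x.
Proof. by move=> du dv; rewrite !derive1E (deriveD du dv). Qed.

Let derive1_scale (a : R) (u : R -> R) x : derivable u x 1 ->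
  derive1 (a *: u) x = a *: derive1 u x.
Proof. by move=> du; rewrite !derive1E (deriveZ a du). Qed.

Let derive1_mul (u v : R -> R) x : derivable u x 1 -> derivable v x 1 ->
  derive1 (u * v) x = u x * derive1 v x + derive1 u x * v x.
Proof.
by move=> du dv; rewrite !derive1E (deriveM du dv) [X in _ + X]mulrC.
Qed.

(* Stated separately to spare the unifier: sections of a product of functions
   of two variables. *)
Let secxM f g b :
  (fun t => (f * g) (t, b)) = (fun t => f (t, b)) * (fun t => g (t, b)).
Proof. by []. Qed.

Let secyM f g a :
  (fun t => (f * g) (a, t)) = (fun t => f (a, t)) * (fun t => g (a, t)).
Proof. by []. Qed.

Lemma pderivxD f g : pderivable f -> pderivable g ->
  pderivx (f + g) = pderivx f + pderivx g.
Proof.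
move=> df dg; apply/funext => p.
have [fx _] := df p; have [gx _] := dg p.
apply: (derive1_add fx gx).
Qed.

Lemma pderivyD f g : pderivable f -> pderivable g ->
  pderivy (f + g) = pderivy f + pderivy g.
Proof.
move=> df dg; apply/funext => p.
have [_ fx] := df p; have [_ gx] := dg p.
apply: (derive1_add fx gx).
Qed.

Lemma pderivableD f g : pderivable f -> pderivable g -> pderivable (f + g).
Proof.
move=> df dg p; have [fx fy] := df p; have [gx gy] := dg p.
by split; [apply: (derivableD fx gx)|apply: (derivableD fy gy)].
Qed.

Lemma pderivxZ (a : R) f : pderivable f -> pderivx (a *: f) = a *: pderivx f.
Proof.
move=> df; apply/funext => p; have [? _] := df p.
exact: derive1_scale.
Qed.

Lemma pderivyZ (a : R) f : pderivable f -> pderivy (a *: f) = a *: pderivy f.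
Proof.
move=> df; apply/funext => p; have [_ ?] := df p.
exact: derive1_scale.
Qed.

Lemma pderivableZ (a : R) f : pderivable f -> pderivable (a *: f).
Proof. by move=> df p; have [? ?] := df p; split; exact: derivableZ. Qed.

Lemma pderivxM f g : pderivable f -> pderivable g ->
  pderivx (f * g) = f * pderivx g + pderivx f * g.
Proof.
move=> df dg; apply/funext => p.
have [fx _] := df p; have [gx _] := dg p.
rewrite /pderivx secxM; rewrite (derive1_mul fx gx).
by rewrite -!surjective_pairing.
Qed.

Lemma pderivyM f g : pderivable f -> pderivable g ->
  pderivy (f * g) = f * pderivy g + pderivy f * g.
Proof.
move=> df dg; apply/funext => p.
have [_ fx] := df p; have [_ gx] := dg p.
rewrite /pderivy secyM; rewrite (derive1_mul fx gx).
by rewrite -!surjective_pairing.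
Qed.

Lemma pderivableM f g : pderivable f -> pderivable g -> pderivable (f * g).
Proof.
move=> df dg p; have [fx fy] := df p; have [gx gy] := dg p.
split; first by rewrite secxM; apply: (derivableM fx gx).
by rewrite secyM; apply: (derivableM fy gy).
Qed.

Lemma pderiv_cst (a : R) :
  [/\ pderivable (cst a), pderivx (cst a) = 0 & pderivy (cst a) = 0].
Proof.
split=> [p||]; first by split; exact: derivable_cst.
  by apply/funext => p; rewrite /pderivx derive1_cst.
by apply/funext => p; rewrite /pderivy derive1_cst.
Qed.

Lemma pderiv_fst :
  [/\ pderivable fst, pderivx fst = cst 1 & pderivy fst = 0].
Proof.
split=> [p||]; first by split; [exact: derivable_id|exact: derivable_cst].
  by apply/funext => p; rewrite /pderivx derive1_id.
by apply/funext => p; rewrite /pderivy derive1_cst.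
Qed.

Lemma pderiv_snd :
  [/\ pderivable snd, pderivx snd = 0 & pderivy snd = cst 1].
Proof.
split=> [p||]; first by split; [exact: derivable_cst|exact: derivable_id].
  by apply/funext => p; rewrite /pderivx derive1_cst.
by apply/funext => p; rewrite /pderivy derive1_id.
Qed.

Lemma classC_cont n g : classC n g -> continuous g.
Proof. by case: n => [|n] // []. Qed.

Lemma classCW n g : classC n.+1 g -> classC n g.
Proof.
elim: n g => [|n IH] g; first by case.
by case=> cg dg gx gy; split; [apply: cg|apply: dg|apply: IH gx|apply: IH gy].
Qed.

Let contD f g : continuous f -> continuous g -> continuous (f + g).
Proof. by move=> cf cg p; apply: (@continuousD _ _ _ f g p); [apply: cf|apply: cg]. Qed.

Let contM f g : continuous f -> continuous g -> continuous (f * g).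
Proof. by move=> cf cg p; apply: (@continuousM _ _ f g p); [apply: cf|apply: cg]. Qed.

Let contZ (a : R) f : continuous f -> continuous (a *: f).
Proof. by move=> cf p; apply: continuousZl_tmp; apply: cf. Qed.

Lemma classCD n f g : classC n f -> classC n g -> classC n (f + g).
Proof.
elim: n f g => [|n IH] f g; first by exact: contD.
move=> [cf df fx fy] [cg dg gx gy]; split.
- apply: (contD cf cg).
- apply: (pderivableD df dg).
- by rewrite (pderivxD df dg); apply: (IH _ _ fx gx).
- by rewrite (pderivyD df dg); apply: (IH _ _ fy gy).
Qed.

Lemma classCZ n (a : R) f : classC n f -> classC n (a *: f).
Proof.
elim: n f => [|n IH] f; first by exact: contZ.
move=> [cf df fx fy]; split.
- apply: (contZ cf).
- apply: (pderivableZ _ df).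
- by rewrite (pderivxZ _ df); apply: (IH _ fx).
- by rewrite (pderivyZ _ df); apply: (IH _ fy).
Qed.

Lemma classCM n f g : classC n f -> classC n g -> classC n (f * g).
Proof.
elim: n f g => [|n IH] f g; first by exact: contM.
move=> Cf Cg; have [cf df fx fy] := Cf; have [cg dg gx gy] := Cg.
move/classCW in Cf; move/classCW in Cg; split.
- apply: (contM cf cg).
- apply: (pderivableM df dg).
- by rewrite (pderivxM df dg); apply: classCD; [apply: (IH _ _ Cf gx)|apply: (IH _ _ fx Cg)].
- by rewrite (pderivyM df dg); apply: classCD; [apply: (IH _ _ Cf gy)|apply: (IH _ _ fy Cg)].
Qed.

Lemma smooth_cst (a : R) : smooth (cst a).
Proof.
move=> n; elim: n a => [|n IH] a; first exact: cst_continuous.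
have [h1 h2 h3] := pderiv_cst a.
split=> //; first exact: cst_continuous.
- by rewrite h2; exact: (IH 0).
- by rewrite h3; exact: (IH 0).
Qed.

Lemma smooth_fst : smooth fst.
Proof.
have [h1 h2 h3] := pderiv_fst.
case=> [|n]; first by move=> p; exact: cvg_fst.
split=> //; first by move=> p; exact: cvg_fst.
- by rewrite h2; exact: smooth_cst.
- by rewrite h3; exact: (@smooth_cst 0).
Qed.

Lemma smooth_snd : smooth snd.
Proof.
have [h1 h2 h3] := pderiv_snd.
case=> [|n]; first by move=> p; exact: cvg_snd.
split=> //; first by move=> p; exact: cvg_snd.
- by rewrite h2; exact: (@smooth_cst 0).
- by rewrite h3; exact: smooth_cst.
Qed.

Lemma smooth_pderivable g : smooth g -> pderivable g.
Proof. by move=> /(_ 1%N) []. Qed.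

Lemma smooth_pderivx g : smooth g -> smooth (pderivx g).
Proof. by move=> sg n; case: (sg n.+1). Qed.

Lemma smooth_pderivy g : smooth g -> smooth (pderivy g).
Proof. by move=> sg n; case: (sg n.+1). Qed.

(* The second difference of [g] on a small square is [h ^+ 2] times a value of
   a mixed derivative in the square, whichever order is used. *)
Let pderivx_is_derive g p : pderivable g ->
  is_derive p.1 1 (fun t => g (t, p.2)) (pderivx g p).
Proof.
move=> /(_ p) [dg _]; rewrite /pderivx derive1E; exact: derivableP.
Qed.

Let pderivy_is_derive g p : pderivable g ->
  is_derive p.2 1 (fun t => g (p.1, t)) (pderivy g p).
Proof.
move=> /(_ p) [_ dg]; rewrite /pderivy derive1E; exact: derivableP.
Qed.

Let swap_difference (A B C D : R) : A - B - (C - D) = A - C - (B - D).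
Proof. by rewrite !opprB [D - C]addrC addrACA [- B + D]addrC. Qed.

Let second_difference g (a b h : R) : 0 < h ->
  pderivable g -> pderivable (pderivx g) ->
  exists2 q, [/\ a < q.1 < a + h & b < q.2 < b + h] &
    g (a + h, b + h) - g (a, b + h) - (g (a + h, b) - g (a, b)) =
    pderivy (pderivx g) q * h ^+ 2.
Proof.
move=> h0 dg dgx.
pose u t := g (t, b + h) - g (t, b).
have du (x : R) : is_derive x 1 u (pderivx g (x, b + h) - pderivx g (x, b)).
  apply: is_deriveB.
    exact: (@pderivx_is_derive g (x, b + h) dg).
  exact: (@pderivx_is_derive g (x, b) dg).
have lta : a < a + h by rewrite ltrDl.
have [|xi xiI] := @MVT _ u _ a (a + h) lta (fun x _ => du x).
  by apply: derivable_within_continuous => x _; case: (du x).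
have addKl (x y : R) : x + y - x = y by rewrite addrC addKr.
rewrite addKl /u => uE.
have dv (x : R) : is_derive x 1 (fun t => pderivx g (xi, t))
    (pderivy (pderivx g) (xi, x)).
  exact: (@pderivy_is_derive (pderivx g) (xi, x) dgx).
have ltb : b < b + h by rewrite ltrDl.
have [|eta etaI] := @MVT _ _ _ b (b + h) ltb (fun x _ => dv x).
  by apply: derivable_within_continuous => x _; case: (dv x).
rewrite addKl => vE.
exists (xi, eta); first by move: xiI etaI; rewrite !in_itv.
by rewrite swap_difference uE vE expr2 mulrA.
Qed.

Let pderivable_swap g :
  pderivable g -> pderivable (fun p => g (p.2, p.1)).
Proof.
move=> dg p; have dgp := dg (p.2, p.1).
exact: (conj (proj2 dgp) (proj1 dgp)).
Qed.

Let in_ball_right (x y h r : R) : x < y < x + h -> h <= r -> `|x - y| < r.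
Proof.
move=> /andP [xy yh] hr; rewrite distrC gtr0_norm ?subr_gt0//.
by rewrite ltrBlDl (lt_le_trans yh)// lerD2l.
Qed.

Let close_trans (x y z e : R) :
  `|x - z| < e / 2 -> `|y - z| < e / 2 -> `|x - y| <= e.
Proof.
move=> xz yz; have -> : x - y = (x - z) - (y - z) by rewrite opprB addrA addrNK.
by rewrite (le_trans (ler_normB _ _))// [leRHS]splitr lerD// ltW.
Qed.

Lemma pderivC g : smooth g -> pderivx (pderivy g) = pderivy (pderivx g).
Proof.
move=> sg; apply/funext => -[a b].
pose A := pderivx (pderivy g); pose B := pderivy (pderivx g).
have cA : continuous A.
  exact: (classC_cont (smooth_pderivx (smooth_pderivy sg) 0)).
have cB : continuous B.
  exact: (classC_cont (smooth_pderivy (smooth_pderivx sg) 0)).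
have meanB h : 0 < h -> exists2 q, [/\ a < q.1 < a + h & b < q.2 < b + h] &
    g (a + h, b + h) - g (a, b + h) - (g (a + h, b) - g (a, b)) =
    B q * h ^+ 2.
  move=> h0; apply: second_difference => //; apply: smooth_pderivable => //.
  exact: smooth_pderivx.
have meanA h : 0 < h -> exists2 q, [/\ a < q.1 < a + h & b < q.2 < b + h] &
    g (a + h, b + h) - g (a, b + h) - (g (a + h, b) - g (a, b)) =
    A q * h ^+ 2.
  move=> h0; pose gs (p : R * R) := g (p.2, p.1).
  have dgs : pderivable gs := pderivable_swap (smooth_pderivable sg).
  have dgsx : pderivable (pderivx gs).
    exact: (pderivable_swap (smooth_pderivable (smooth_pderivy sg))).
  have [[x y] /= [hx hy] E] := second_difference b a h0 dgs dgsx.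
  exists (y, x) => //; rewrite -[RHS]E /gs /=; exact: swap_difference.
change (A (a, b) = B (a, b)); apply/eqP; rewrite -subr_eq0 -normr_le0.
apply/ler_addgt0Pl => e e0; rewrite addr0.
have e20 : 0 < e / 2 by rewrite divr_gt0.
have /cvgrPdist_lt /(_ _ e20) := cA (a, b).
have /cvgrPdist_lt /(_ _ e20) := cB (a, b).
move=> /nbhs_ballP [r1 r10 H1] /nbhs_ballP [r2 r20 H2].
pose h := Num.min r1 r2.
have h0 : 0 < h by rewrite lt_min r10 r20.
have [q [qa qb] EB] := meanB _ h0; have [q' [q'a q'b] EA] := meanA _ h0.
have ABq : A q' = B q.
  apply: (@mulIf _ (h ^+ 2)); first by rewrite expf_neq0 ?gt_eqF.
  exact: (etrans (esym EA) EB).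
have hr1 : h <= r1 by rewrite ge_min lexx.
have hr2 : h <= r2 by rewrite ge_min lexx orbT.
have {H1} /= H1 := H1 q (conj (in_ball_right qa hr1) (in_ball_right qb hr1)).
have {H2} /= H2 := H2 q' (conj (in_ball_right q'a hr2) (in_ball_right q'b hr2)).
rewrite ABq in H2; exact: (close_trans H2 H1).
Qed.

End Smooth.

Section SmoothAlgebra.
Variable R : realType.

Definition is_smooth : {pred R * R -> R} := fun g => `[< smooth g >].

Fact is_smoothP g : reflect (smooth g) (g \in is_smooth).
Proof. exact: asboolP. Qed.

Fact is_smooth_submod : submod_closed is_smooth.
Proof.
split=> [|a u v /is_smoothP su /is_smoothP sv]; apply/is_smoothP.
  exact: (@smooth_cst R 0).
by move=> n; apply: (classCD (classCZ a (su n)) (sv n)).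
Qed.

Fact is_smooth_mulr : mulr_closed is_smooth.
Proof.
split=> [|u v /is_smoothP su /is_smoothP sv]; apply/is_smoothP.
  exact: (@smooth_cst R 1).
by move=> n; apply: (classCM (su n) (sv n)).
Qed.

HB.instance Definition _ := GRing.isSubmodClosed.Build R (R * R -> R) is_smooth
  (GRing.submod_closed_semi is_smooth_submod).
HB.instance Definition _ := GRing.isMulClosed.Build (R * R -> R) is_smooth
  is_smooth_mulr.

Definition Cinf : Type := {g : R * R -> R | g \in is_smooth}.

HB.instance Definition _ := SubChoice.on Cinf.
HB.instance Definition _ := [SubChoice_isSubComNzRing of Cinf by <:].
HB.instance Definition _ := [SubZmodule_isSubLmodule of Cinf by <:].

Definition Cinf_fun (g : Cinf) : R * R -> R := val g.
Coercion Cinf_fun : Cinf >-> Funclass.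

Lemma CinfP (g h : Cinf) : g =1 h -> g = h.
Proof. by move=> gh; apply/val_inj/funext. Qed.

Lemma Cinf_smooth (g : Cinf) : smooth g.
Proof. exact/is_smoothP/(valP g). Qed.

Lemma CinfD (g h : Cinf) p : Cinf_fun (g + h) p = g p + h p.
Proof. by []. Qed.

Lemma CinfM (g h : Cinf) p : Cinf_fun (g * h) p = g p * h p.
Proof. by []. Qed.

Lemma CinfX (g : Cinf) n p : Cinf_fun (g ^+ n) p = g p ^+ n.
Proof. by elim: n => [|n IH] //; rewrite !exprS CinfM IH. Qed.

Lemma CinfZ (a : R) (g : Cinf) p : Cinf_fun (a *: g) p = a * g p.
Proof. by []. Qed.

Definition mkCinf (g : R * R -> R) (sg : smooth g) : Cinf :=
  exist _ g (introT (is_smoothP _) sg).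

Definition coordx : Cinf := mkCinf (@smooth_fst R).
Definition coordy : Cinf := mkCinf (@smooth_snd R).

Definition ddx (g : Cinf) : Cinf := mkCinf (smooth_pderivx (Cinf_smooth g)).
Definition ddy (g : Cinf) : Cinf := mkCinf (smooth_pderivy (Cinf_smooth g)).

Fact ddx_is_linear : linear ddx.
Proof.
move=> a g h; apply: val_inj => /=.
have dg := smooth_pderivable (Cinf_smooth g).
have dh := smooth_pderivable (Cinf_smooth h).
by rewrite (pderivxD (pderivableZ a dg) dh) (pderivxZ a dg).
Qed.

HB.instance Definition _ := GRing.isLinear.Build R Cinf Cinf _ ddx ddx_is_linear.

Fact ddy_is_linear : linear ddy.
Proof.
move=> a g h; apply: val_inj => /=.
have dg := smooth_pderivable (Cinf_smooth g).
have dh := smooth_pderivable (Cinf_smooth h).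
by rewrite (pderivyD (pderivableZ a dg) dh) (pderivyZ a dg).
Qed.

HB.instance Definition _ := GRing.isLinear.Build R Cinf Cinf _ ddy ddy_is_linear.

Lemma ddxM g h : ddx (g * h) = g * ddx h + ddx g * h.
Proof.
apply: val_inj => /=; rewrite pderivxM //; apply: smooth_pderivable;
  exact: Cinf_smooth.
Qed.

Lemma ddyM g h : ddy (g * h) = g * ddy h + ddy g * h.
Proof.
apply: val_inj => /=; rewrite pderivyM //; apply: smooth_pderivable;
  exact: Cinf_smooth.
Qed.

Lemma ddxC g : ddx (ddy g) = ddy (ddx g).
Proof. by apply: val_inj; exact: pderivC (Cinf_smooth g). Qed.

Lemma CinfZAl (a : R) (g h : Cinf) : a *: (g * h) = (a *: g) * h.
Proof. by apply: CinfP => p; apply: mulrA. Qed.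

Lemma CinfZAr (a : R) (g h : Cinf) : a *: (g * h) = g * (a *: h).
Proof. by rewrite mulrC CinfZAl mulrC. Qed.

End SmoothAlgebra.

Section DeRham.
Variable R : realType.
Local Notation A := (Cinf R).

(* [P dx + Q dy] is the pair [(P, Q)] and [h dx /\ dy] is [h]. *)
Definition form (k : nat) : lmodType R :=
  match k with
  | 0 => A
  | 1 => (A * A)%type
  | 2 => A
  | _ => 'rV[R]_0
  end.

Definition extd (k : nat) : form k -> form k.+1 :=
  match k return form k -> form k.+1 with
  | 0 => fun g => (ddx g, ddy g)
  | 1 => fun w => ddx w.2 - ddy w.1
  | _ => fun=> 0
  end.

Definition fmul (k : nat) (f : A) : form k -> form k :=
  match k return form k -> form k with
  | 0 => fun w => f * w
  | 1 => fun w => (f * w.1, f * w.2)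
  | 2 => fun w => f * w
  | _ => fun=> 0
  end.

(* [wedge1 t w] is [t /\ w] for a 1-form [t]. *)
Definition wedge1 (k : nat) (t : form 1) : form k -> form k.+1 :=
  match k return form k -> form k.+1 with
  | 0 => fun g => (t.1 * g, t.2 * g)
  | 1 => fun w => t.1 * w.2 - t.2 * w.1
  | _ => fun=> 0
  end.

Fact extd_is_linear k : linear (@extd k).
Proof.
case: k => [|[|k]] a u v /=; first by rewrite !linearP.
  have -> : ddx (a *: u + v).2 = a *: ddx u.2 + ddx v.2 by exact: linearP.
  have -> : ddy (a *: u + v).1 = a *: ddy u.1 + ddy v.1 by exact: linearP.
  by rewrite scalerBr opprD addrACA.
by rewrite scaler0 addr0.
Qed.

HB.instance Definition _ k :=
  GRing.isLinear.Build R (form k) (form k.+1) _ (@extd k) (@extd_is_linear k).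

Lemma extdK k (w : form k) : extd (extd w) = 0.
Proof.
case: k w => [|[|k]] w //=.
by rewrite ddxC subrr.
Qed.

Lemma fmulZ k (a : R) f (w : form k) : a *: fmul f w = fmul f (a *: w).
Proof.
case: k w => [|[|[|k]]] w /=; rewrite ?CinfZAr ?scaler0 //.
by congr (_, _); exact: CinfZAr.
Qed.

Lemma wedge1Z k (a : R) t (w : form k) : a *: wedge1 t w = wedge1 t (a *: w).
Proof.
case: k w => [|[|k]] w /=; rewrite ?scaler0 //.
  by congr (_, _); exact: CinfZAr.
by rewrite scalerBr !CinfZAr.
Qed.

Variable f : A.

Definition ideal : set A := [set h | exists a : A, h = a * f].

(* Paired lists [(f_i, alpha_i)] and [(g_j, beta_j)] encode the sum
   [\sum_i f_i alpha_i + \sum_j dg_j /\ beta_j]. *)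
Definition diff_ideal (k : nat) : set (form k) :=
  match k return set (form k) with
  | 0 => ideal
  | j.+1 => [set w | exists (s : seq (A * form j.+1)) (t : seq (A * form j)),
      [/\ forall u, u \in s -> ideal u.1, forall v, v \in t -> ideal v.1 &
          w = \sum_(u <- s) fmul u.1 u.2 +
              \sum_(v <- t) wedge1 (extd (v.1 : form 0)) v.2]]
  end.

Definition in_diff_ideal (k : nat) : {pred form k} :=
  fun w => `[< diff_ideal w >].

Lemma idealP a g h : ideal g -> ideal h -> ideal (a * g + h).
Proof. by case=> b -> [c ->]; exists (a * b + c); rewrite mulrDl mulrA. Qed.

Lemma ideal0 : ideal 0.
Proof. by exists 0; rewrite mul0r. Qed.

Lemma idealN g : ideal g -> ideal (- g).
Proof. by case=> a ->; exists (- a); rewrite mulNr. Qed.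

Fact in_diff_ideal_submod k : submod_closed (@in_diff_ideal k).
Proof.
case: k => [|k]; split=> [|a x y /asboolP hx /asboolP hy]; apply/asboolP.
- exact: ideal0.
- rewrite /= -[x]mul1r CinfZAl; exact: idealP.
- by exists [::], [::]; split; rewrite // !big_nil addr0.
case: hx => s1 [t1 [hs1 ht1 ->]]; case: hy => s2 [t2 [hs2 ht2 ->]].
exists ([seq (u.1, a *: u.2) | u <- s1] ++ s2),
       ([seq (u.1, a *: u.2) | u <- t1] ++ t2); split.
- move=> u; rewrite mem_cat => /orP [/mapP [v vs ->]|]; last exact: (hs2 u).
  exact: (hs1 v vs).
- move=> u; rewrite mem_cat => /orP [/mapP [v vs ->]|]; last exact: (ht2 u).
  exact: (ht1 v vs).
rewrite !big_cat !big_map scalerDr addrACA !scaler_sumr.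
by congr (_ + _ + (_ + _)); apply: eq_bigr => u _; rewrite ?fmulZ ?wedge1Z.
Qed.

HB.instance Definition _ k := GRing.isSubmodClosed.Build R (form k)
  (@in_diff_ideal k) (GRing.submod_closed_semi (@in_diff_ideal_submod k)).

Lemma diff_ideal_extd k (w : form k) :
  w \in @in_diff_ideal k -> extd w \in @in_diff_ideal k.+1.
Proof.
move=> /asboolP hw; apply/asboolP.
case: k w hw => [|[|k]] w hw.
- exists [::], [:: (w, 1 : form 0)]; split=> //.
    by move=> v; rewrite inE => /eqP ->.
  by rewrite big_nil big_seq1 add0r /= !mulr1.
- case: hw => s [t [hs ht ->]].
  exists [seq (u.1, extd u.2) | u <- s],
    ([seq (u.1, u.2) | u <- s] ++ [seq (- v.1, extd v.2) | v <- t]).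
  split.
  + by move=> u /mapP [v vs ->]; exact: (hs v vs).
  + move=> u; rewrite mem_cat => /orP [] /mapP [v vs ->]; first exact: (hs v vs).
    by apply: idealN; exact: (ht v vs).
  rewrite big_cat !big_map addrA linearD !linear_sum -big_split.
  congr (_ + _); apply: eq_bigr => -[g b] _ /=.
    rewrite ddxM ddyM opprD addrACA; congr (_ + _).
    by rewrite mulrBr.
  rewrite !linearN /= ddxM ddyM ddxC opprD addrACA subrr addr0.
  by rewrite !mulNr opprK addrC.
- by exists [::], [::]; split=> //; rewrite !big_nil addr0.
Qed.

(* The sheaf of forms modulo the differential ideal is a sheaf of modules over
   smooth functions, hence fine; the complex of sheaves is represented by its
   global sections, the quotient of global forms by the global ideal. *)
Definition deRham_form (k : nat) : lmodType R := qmod (@in_diff_ideal k).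

Definition deRham_d (k : nat) : {linear deRham_form k -> deRham_form k.+1} :=
  qmap (@diff_ideal_extd k).

Lemma deRham_dE k (w : form k) :
  deRham_d k (qproj (@in_diff_ideal k) w) = qproj (@in_diff_ideal k.+1) (extd w).
Proof. exact: qmapE. Qed.

Fact deRham_dK k (x : deRham_form k) : deRham_d k.+1 (deRham_d k x) = 0.
Proof.
by rewrite -[x]qreprK !deRham_dE extdK linear0.
Qed.

Definition deRham : cochain_complex R := CochainComplex deRham_dK.

Definition zero_set : set (R * R) := [set p | f p = 0].

End DeRham.

Section Simplex.
Variable R : realType.

Definition std_simplex (n : nat) : set 'rV[R]_n.+1 :=
  [set t | (forall i, 0 <= t ord0 i) /\ \sum_i t ord0 i = 1].

Arguments std_simplex : clear implicits.

Definition insert0 (n : nat) (i : 'I_n.+2) (t : 'rV[R]_n.+1) : 'rV[R]_n.+2 :=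
  \row_j oapp (t ord0) 0 (unlift i j).

Fact insert0_simplex n (i : 'I_n.+2) (t : std_simplex n) :
  insert0 i (val t) \in std_simplex n.+1.
Proof.
apply/mem_set; have [t0 t1] := set_mem (valP t); split=> [j|].
  by rewrite mxE; case: unlift => //= k; exact: t0.
rewrite (bigD1_ord i) //= mxE unlift_none /= add0r -[RHS]t1.
by apply: eq_bigr => j _; rewrite mxE liftK.
Qed.

Definition face (n : nat) (i : 'I_n.+2) (t : std_simplex n) : std_simplex n.+1 :=
  exist _ (insert0 i (val t)) (insert0_simplex i t).

Fact insert0_continuous n (i : 'I_n.+2) : continuous (@insert0 n i).
Proof.
move=> t U /= [P Pn PU].
exists (fun a k => P a (lift i k)) => [a k|s Ps].
  by rewrite [a]ord1; have := Pn ord0 (lift i k); rewrite mxE liftK.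
apply: PU => a j; rewrite [a]ord1 mxE.
case: unliftP (Pn ord0 j) => [k ->|->] /=; first by move=> _; exact: Ps.
by rewrite mxE unlift_none; exact: nbhs_singleton.
Qed.

Fact face_continuous n (i : 'I_n.+2) : continuous (@face n i).
Proof.
apply: continuous_comp_initial => t.
have cv : continuous (set_val : std_simplex n -> 'rV[R]_n.+1).
  exact: initial_continuous.
exact: (@continuous_comp _ _ _ set_val (@insert0 n i) t (cv t)
  (@insert0_continuous n i _)).
Qed.

HB.instance Definition _ n (i : 'I_n.+2) :=
  @isContinuous.Build (std_simplex n) (std_simplex n.+1) (@face n i)
    (@face_continuous n i).

Lemma face_face n (i j : nat) (t : std_simplex n) : (j <= i)%N -> (i <= n.+1)%N ->
  face (inord i.+1) (face (inord j) t) = face (inord j) (face (inord i) t).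
Proof.
move=> ji ilt; apply: val_inj => /=; apply/rowP => k; rewrite !mxE.
have jlt : (j < n.+2)%N by rewrite ltnS (leq_trans ji).
pose a : 'I_n.+3 := inord i.+1; pose b : 'I_n.+3 := inord j.
pose c : 'I_n.+2 := inord j; pose e : 'I_n.+2 := inord i.
have aE : a = i.+1 :> nat by rewrite inordK // !ltnS.
have bE : b = j :> nat by rewrite inordK // (leq_trans jlt).
have cE : c = j :> nat by rewrite inordK.
have eE : e = i :> nat by rewrite inordK // ltnS.
rewrite -/a -/b -/c -/e.
case: (unliftP a k) => [k1 kE1|kE1] /=; case: (unliftP b k) => [k2 kE2|kE2] /=;
  rewrite ?mxE //.
- have : bump i.+1 k1 = bump j k2.
    by rewrite -aE -bE; have := congr1 val kE1; rewrite kE2 /= => ->.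
  case: (unliftP c k1) => [l1 lE1|lE1]; case: (unliftP e k2) => [l2 lE2|lE2] //=;
    rewrite lE1 lE2 /= cE eE /bump.
  + by move=> h; congr (_ _ _); apply: val_inj => /=; lia.
  + by lia.
  + by lia.
- have : bump i.+1 k1 = j.
    by rewrite -aE -bE; have := congr1 val kE1; rewrite kE2 /= => ->.
  case: (unliftP c k1) => [l1 ->|//] /=; rewrite cE /bump; lia.
- have : bump j k2 = i.+1.
    by rewrite -aE -bE; have := congr1 val kE2; rewrite kE1 /= => ->.
  case: (unliftP e k2) => [l2 ->|//] /=; rewrite eE /bump; lia.
Qed.

End Simplex.

Arguments std_simplex : clear implicits.

Section AlternatingSum.

Lemma alternating_double_sum (V : zmodType) (n : nat) (F : nat -> nat -> V) :
  (forall i j, (j <= i)%N -> (i < n)%N -> F i.+1 j = - F j i) ->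
  \sum_(i < n.+1) \sum_(j < n) F i j = 0.
Proof.
move=> FE.
rewrite (eq_bigr (fun i : 'I_n.+1 => \sum_(j < n | (j < i)%N) F i j +
    \sum_(j < n | (i <= j)%N) F i j)); last first.
  move=> i _; rewrite (bigID (fun j : 'I_n => (j < i)%N)) /=; congr (_ + _).
  by apply: eq_bigl => j; rewrite -leqNgt.
rewrite big_split /= big_ord_recl big_pred0 // add0r.
rewrite [X in _ + X]big_ord_recr /= [X in _ + (_ + X)]big_pred0; last first.
  by move=> j; rewrite leqNgt ltn_ord.
rewrite addr0 [X in _ + X](exchange_big_dep xpredT) //= -big_split /=.
rewrite big1 // => i _; rewrite /bump /= add1n.
rewrite -big_split /= big1 // => j; rewrite ltnS => ji.
by rewrite FE // addNr.
Qed.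

End AlternatingSum.

Section Singular.
Variables (R : realType) (T : topologicalType).

Definition singular_simplex (n : nat) : Type :=
  continuousType (std_simplex R n) T.

Definition simplex_face (n : nat) (i : 'I_n.+2) (s : singular_simplex n.+1) :
  singular_simplex n := s \o face i.

(* R-linear forms on singular chains are functions on singular simplices. *)
Definition singular_cochain (n : nat) : lmodType R := singular_simplex n -> R.

Definition singular_delta (n : nat) (phi : singular_cochain n) :
  singular_cochain n.+1 :=
  fun s => \sum_(i < n.+2) (-1) ^+ i * phi (simplex_face i s).

Fact singular_delta_is_linear n : linear (@singular_delta n).
Proof.
move=> a phi psi; apply/funext => s.
change (singular_delta (a *: phi + psi) s =
  a * singular_delta phi s + singular_delta psi s).
rewrite /singular_delta mulr_sumr -big_split; apply: eq_bigr => i _ /=.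
change ((-1) ^+ i * (a * phi (simplex_face i s) + psi (simplex_face i s)) =
  a * ((-1) ^+ i * phi (simplex_face i s)) + (-1) ^+ i * psi (simplex_face i s)).
by rewrite mulrDr mulrCA.
Qed.

HB.instance Definition _ n := GRing.isLinear.Build R (singular_cochain n)
  (singular_cochain n.+1) _ (@singular_delta n) (@singular_delta_is_linear n).

Fact singular_deltaK n (phi : singular_cochain n) :
  singular_delta (singular_delta phi) = 0.
Proof.
apply/funext => s; rewrite /singular_delta.
pose F i j := (-1) ^+ i * ((-1) ^+ j *
  phi (simplex_face (inord j) (simplex_face (inord i) s))).
rewrite (eq_bigr (fun i : 'I_n.+3 => \sum_(j < n.+2) F i j)); last first.
  by move=> i _; rewrite mulr_sumr; apply: eq_bigr => j _; rewrite /F !inord_val.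
apply: alternating_double_sum => i j ji ilt; rewrite /F.
have -> : simplex_face (inord j) (simplex_face (inord i.+1) s) =
          simplex_face (inord i) (simplex_face (inord j) s).
  by apply/continuousEP => t; rewrite /= face_face.
by rewrite exprS mulN1r mulNr mulrCA.
Qed.

Definition singular_d n : {linear singular_cochain n -> singular_cochain n.+1} :=
  @singular_delta n.

Definition singular : cochain_complex R :=
  @CochainComplex R singular_cochain singular_d singular_deltaK.

End Singular.

(* Main.v *)
Require Import Defs.
From mathcomp Require Import all_boot all_order all_algebra.
From mathcomp Require Import all_classical all_reals all_analysis.
From mathcomp Require Import ring lra.

Set Implicit Arguments.
Unset Strict Implicit.
Unset Printing Implicit Defensive.

Import Order.TTheory GRing.Theory Num.Theory numFieldNormedType.Exports.
Local Open Scope classical_set_scope.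
Local Open Scope ring_scope.

(** The two cohomologies already differ in degree 1: the singular one vanishes
while the de Rham one does not.

Singular side ([curve_H1_eq0]).  Putting [x = t y] in [f] and dividing by
[y ^+ 4] gives [y = - t ^+ 4 / (1 + t)], so the slope [t = x / y] identifies
the zero set with the line minus the point [-1].  At the origin the slope is 0,
and it is continuous there because [t ^+ 4 = - (x + y)] on the curve.  A space
homeomorphic to a part [I] of the line has no [H^1] ([singular_H1_eq0]): choose
a base point in each component of [I]; a path stays in one component, and the
cone on it from the base point is a singular 2-simplex.  A cocycle vanishes on
the boundary of that simplex, so its value on the path is the difference of its
values on the two straight rays from the base point to the endpoints.

De Rham side ([deRham_H1_neq0]).  Take [w] with [dw = f dx /\ dy].  It is
closed modulo the differential ideal.  Every 1-form of that ideal is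
[dg + f v] ([diff_ideal1]), so if [w] were exact modulo the ideal then
[f dx /\ dy] would be [d (f v)] for some 1-form [v]; in other words
[f = ddx (f u) + ddy (f w)] for smooth [u], [w].  For a quasi-homogeneous
polynomial a multiple of the Euler field solves this equation.  Here the term
[y ^+ 4 * x], of higher weight than [x ^+ 4 + y ^+ 5], obstructs it: comparing
seven Taylor coefficients at the origin yields inconsistent linear equations
for the 1-jets of [u] and [w] ([quintic_not_divergence]). *)

(** * Taylor coefficients at the origin *)

Section Taylor.
Variable R : realType.
Implicit Types (g h : Cinf R) (i j n : nat).
Local Notation x := (coordx R).
Local Notation y := (coordy R).
Local Notation dx := (@ddx R).
Local Notation dy := (@ddy R).

Lemma ddx_coordx : ddx x = 1.
Proof. by apply: val_inj => /=; case: (pderiv_fst R). Qed.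

Lemma ddy_coordx : ddy x = 0.
Proof. by apply: val_inj => /=; case: (pderiv_fst R). Qed.

Lemma ddx_coordy : ddx y = 0.
Proof. by apply: val_inj => /=; case: (pderiv_snd R). Qed.

Lemma ddy_coordy : ddy y = 1.
Proof. by apply: val_inj => /=; case: (pderiv_snd R). Qed.

Lemma ddx1 : ddx (1 : Cinf R) = 0.
Proof. by apply: val_inj => /=; case: (pderiv_cst (1 : R)). Qed.

Lemma ddy1 : ddy (1 : Cinf R) = 0.
Proof. by apply: val_inj => /=; case: (pderiv_cst (1 : R)). Qed.

Lemma ddxD g h : ddx (g + h) = ddx g + ddx h.
Proof. exact: linearD. Qed.

Lemma ddyD g h : ddy (g + h) = ddy g + ddy h.
Proof. exact: linearD. Qed.

Lemma ddxMn g n : ddx (g *+ n) = ddx g *+ n.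
Proof. exact: linearMn. Qed.

Lemma ddyMn g n : ddy (g *+ n) = ddy g *+ n.
Proof. exact: linearMn. Qed.

Lemma CinfMn g n p : Cinf_fun (g *+ n) p = g p *+ n.
Proof. by elim: n => [|n IH] //; rewrite !mulrS CinfD IH. Qed.

Lemma iter_ddx0 n : iter n dx 0 = 0.
Proof. by elim: n => //= n ->; exact: linear0. Qed.

Lemma iter_ddy0 n : iter n dy 0 = 0.
Proof. by elim: n => //= n ->; exact: linear0. Qed.

Lemma iter_ddxD i g h : iter i dx (g + h) = iter i dx g + iter i dx h.
Proof. by elim: i => //= i ->; rewrite ddxD. Qed.

Lemma iter_ddyD i g h : iter i dy (g + h) = iter i dy g + iter i dy h.
Proof. by elim: i => //= i ->; rewrite ddyD. Qed.

Lemma iter_ddxMn i g n : iter i dx (g *+ n) = iter i dx g *+ n.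
Proof. by elim: i => //= i ->; rewrite ddxMn. Qed.

Lemma iter_ddx_ddy i j g : iter j dy (ddx g) = ddx (iter j dy g).
Proof. by elim: j => //= j ->; rewrite ddxC. Qed.

Lemma iter_ddx_coordx i g :
  iter i dx (x * g) = x * iter i dx g + iter i.-1 dx g *+ i.
Proof.
elim: i => [|i IH]; first by rewrite /= addr0.
rewrite iterS IH ddxD ddxMn ddxM ddx_coordx mul1r -addrA; congr (_ + _).
by case: i {IH} => [|i]; rewrite /= ?addr0 // mulrS.
Qed.

Lemma iter_ddx_coordy i g : iter i dx (y * g) = y * iter i dx g.
Proof. by elim: i => //= i ->; rewrite ddxM ddx_coordy mul0r addr0. Qed.

Lemma iter_ddy_coordx j g : iter j dy (x * g) = x * iter j dy g.
Proof. by elim: j => //= j ->; rewrite ddyM ddy_coordx mul0r addr0. Qed.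

Lemma iter_ddy_coordy j g :
  iter j dy (y * g) = y * iter j dy g + iter j.-1 dy g *+ j.
Proof.
elim: j => [|j IH]; first by rewrite /= addr0.
rewrite iterS IH ddyD ddyMn ddyM ddy_coordy mul1r -addrA; congr (_ + _).
by case: j {IH} => [|j]; rewrite /= ?addr0 // mulrS.
Qed.

Definition taylor i j g : R :=
  iter i dx (iter j dy g) (0, 0) / (i`! * j`!)%:R.
Arguments taylor : simpl never.

Lemma taylorD i j g h : taylor i j (g + h) = taylor i j g + taylor i j h.
Proof. by rewrite /taylor iter_ddyD iter_ddxD CinfD mulrDl. Qed.

Lemma natSM_neq0 n : n.+1%:R != 0 :> R.
Proof. by rewrite pnatr_eq0. Qed.

Lemma taylor1 i j : taylor i j 1 = ((i == 0%N) && (j == 0%N))%:R.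
Proof.
rewrite /taylor; case: j => [|j]; last first.
  by rewrite iterSr ddy1 iter_ddy0 iter_ddx0 mul0r andbF.
case: i => [|i]; last by rewrite iterSr ddx1 iter_ddx0 mul0r.
by rewrite /= divr1.
Qed.

Lemma taylor_ddx i j g : taylor i j (ddx g) = i.+1%:R * taylor i.+1 j g.
Proof.
rewrite /taylor iter_ddx_ddy // -iterSr factS -mulnA (natrM _ _.+1) mulrCA.
by congr (_ * _); rewrite invfM mulrA divff ?natSM_neq0 // mul1r.
Qed.

Lemma taylor_ddy i j g : taylor i j (ddy g) = j.+1%:R * taylor i j.+1 g.
Proof.
rewrite /taylor -iterSr factS mulnCA (natrM _ _.+1) mulrCA.
by congr (_ * _); rewrite invfM mulrA divff ?natSM_neq0 // mul1r.
Qed.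

Lemma taylor_coordx i j g :
  taylor i j (x * g) = if i is i'.+1 then taylor i' j g else 0.
Proof.
rewrite /taylor iter_ddy_coordx iter_ddx_coordx CinfD CinfM CinfMn mul0r add0r.
case: i => [|i]; first by rewrite mulr0n mul0r.
rewrite -(mulr_natr (Cinf_fun _ _)) factS -mulnA (natrM _ _.+1) invfM !mulrA.
by rewrite mulfK ?natSM_neq0.
Qed.

Lemma taylor_coordy i j g :
  taylor i j (y * g) = if j is j'.+1 then taylor i j' g else 0.
Proof.
rewrite /taylor iter_ddy_coordy iter_ddxD iter_ddxMn iter_ddx_coordy.
rewrite CinfD CinfM CinfMn mul0r add0r.
case: j => [|j]; first by rewrite mulr0n mul0r.
rewrite -(mulr_natr (Cinf_fun _ _)) factS mulnCA (natrM _ _.+1) invfM !mulrA.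
by rewrite mulfK ?natSM_neq0.
Qed.

Lemma taylor_coordxX n i j g :
  taylor i j (x ^+ n * g) = if (n <= i)%N then taylor (i - n) j g else 0.
Proof.
elim: n i => [|n IH] i; first by rewrite expr0 mul1r subn0.
by rewrite exprS -mulrA taylor_coordx; case: i => [|i] //; rewrite IH subSS.
Qed.

Lemma taylor_coordyX n i j g :
  taylor i j (y ^+ n * g) = if (n <= j)%N then taylor i (j - n) g else 0.
Proof.
elim: n j => [|n IH] j; first by rewrite expr0 mul1r subn0.
by rewrite exprS -mulrA taylor_coordy; case: j => [|j] //; rewrite IH subSS.
Qed.

Definition quintic : Cinf R := x ^+ 4 + y ^+ 5 + y ^+ 4 * x.

Lemma taylor_quinticM i j g : taylor i j (quintic * g) =
  (if (4 <= i)%N then taylor (i - 4) j g else 0) +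
  (if (5 <= j)%N then taylor i (j - 5) g else 0) +
  (if (4 <= j)%N then taylor i (j - 4) (x * g) else 0).
Proof.
rewrite /quintic !mulrDl -mulrA !taylorD.
by rewrite (taylor_coordxX 4) (taylor_coordyX 5) (taylor_coordyX 4).
Qed.

(** Give [x] weight 5 and [y] weight 4.  Weights below 20 force the values of
[u] and [w] and the derivative of [u] along [y] to vanish at the origin.  In
weight 20 the coefficients of [x ^+ 4] and [y ^+ 5] determine [ddx u] and
[ddy w] there, in weight 21 that of [x y ^+ 4] then makes [ddx w] nonzero, and
in weight 22 that of [x ^+ 2 * y ^+ 3] makes it zero. *)
Lemma quintic_not_divergence (u w : Cinf R) :
  quintic <> ddx (quintic * u) + ddy (quintic * w).
Proof.
move=> E.
have J i j : taylor i j (quintic * 1) =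
    i.+1%:R * taylor i.+1 j (quintic * u) +
    j.+1%:R * taylor i j.+1 (quintic * w).
  by rewrite mulr1 {1}E taylorD taylor_ddx taylor_ddy.
move: (J 3 0)%N (J 0 4)%N (J 3 1)%N (J 4 0)%N (J 0 5)%N (J 1 4)%N (J 2 3)%N.
rewrite !taylor_quinticM !taylor_coordx !taylor1 /= !subSS !subn0.
by move=> {J}; lra.
Qed.

End Taylor.

(** * De Rham cohomology in degree 1 *)

Section DifferentialIdeal.
Variable R : realType.
Local Notation form := (Defs.form R).
Implicit Types (a f : Cinf R).

Lemma extdD k (v w : form k) : extd (v + w) = extd v + extd w.
Proof. exact: linearD. Qed.

Lemma fmulDr k a (v w : form k) : fmul a (v + w) = fmul a v + fmul a w.
Proof.
case: k v w => [|[|[|k]]] v w /=; rewrite ?mulrDr ?addr0 //.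
Qed.

Lemma fmulNr a (w : form 1) : fmul a (- w) = - fmul a w.
Proof. by congr (_, _); exact: mulrN. Qed.

Lemma fmulA a f (w : form 1) : fmul (a * f) w = fmul f (fmul a w).
Proof. by congr (_, _) => /=; rewrite mulrAC [RHS]mulrC. Qed.

Lemma wedge1_extd (g h : form 0) :
  wedge1 (extd g) h = extd ((g : Cinf R) * h : form 0) - fmul g (extd h).
Proof. by congr (_, _); rewrite /= ?ddxM ?ddyM addrC addKr. Qed.

(** By the Leibniz rule, [d (b f) h = d (b f h) - f (b dh)], so the generators
of the ideal that involve differentials are exact up to multiples of [f]. *)
Lemma diff_ideal1 f (w : form 1) : diff_ideal f w ->
  exists (g : form 0) (v : form 1), w = extd g + fmul f v.
Proof.
pose P (w : form 1) := exists (g : form 0) (v : form 1), w = extd g + fmul f v.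
have P0 : P 0 by exists 0, 0; rewrite linear0 add0r; congr (_, _); rewrite mulr0.
have PD v1 v2 : P v1 -> P v2 -> P (v1 + v2).
  move=> [g1 [w1 ->]] [g2 [w2 ->]]; exists (g1 + g2), (w1 + w2).
  by rewrite linearD fmulDr addrACA.
case=> s [t [sf tf ->]]; apply: (PD).
  rewrite big_seq; apply: big_ind => // -[g a] /sf [b gE].
  by exists 0, (fmul b a); rewrite linear0 add0r gE fmulA.
rewrite big_seq; apply: big_ind => // -[g a] /tf [b gE].
exists ((g : Cinf R) * a : form 0), (- fmul b (extd a)).
by rewrite wedge1_extd fmulNr -fmulA -gE.
Qed.

End DifferentialIdeal.

Section DeRhamH1.
Variable R : realType.
Local Notation form := (Defs.form R).
Local Notation x := (coordx R).
Local Notation y := (coordy R).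
Local Notation f := (quintic R).

Definition quintic_primitive : form 1 :=
  (0, (5%:R^-1 : R) *: x ^+ 5 + x * y ^+ 5 +
      (2%:R^-1 : R) *: (x ^+ 2 * y ^+ 4)).

Lemma extd_quintic_primitive : extd quintic_primitive = f.
Proof.
rewrite /= [ddy 0]linear0 subr0 !ddxD.
have dZ (c : R) (g : Cinf R) : ddx (c *: g) = c *: ddx g by exact: linearZ.
rewrite !dZ !exprS !expr0 !mulr1 !ddxM !ddx_coordx !ddx_coordy.
apply: CinfP => p.
rewrite /quintic !(mulr0, mul0r, addr0, mulr1, mul1r).
rewrite !(CinfD, CinfZ, CinfM).
by rewrite (_ : (0 : Cinf R) p = 0) //; field.
Qed.

Lemma deRham_H1_neq0 : exists z : cohomology (deRham f) 1, z != 0.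
Proof.
have cw : deRham_d f 1 (qproj (in_diff_ideal f (k:=1)) quintic_primitive) = 0.
  rewrite deRham_dE extd_quintic_primitive.
  rewrite -[RHS](linear0 (qproj (in_diff_ideal f (k:=2)))).
  apply/qprojP/asboolP; rewrite subr0.
  exists [:: (f, 1 : form 2)], [::]; split=> //.
    by move=> u; rewrite inE => /eqP ->; exists 1; rewrite mul1r.
  by rewrite big_nil addr0 big_seq1 /= mulr1.
pose z : cocycle (deRham f) 1 :=
  exist (fun w : deRham f 1 => w \in is_cocycle (C := deRham f) (k := 1))
    (qproj _ quintic_primitive) (introT eqP cw).
exists (qproj (is_coboundary (C := deRham f) (k := 1)) z); apply/negP => /eqP.
rewrite -[RHS](linear0 (qproj _)) => /qprojP.
rewrite subr0 => /asboolP [g0 _].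
change (deRham_d f 0 g0 = qproj _ quintic_primitive -> False).
rewrite -[g0]qreprK deRham_dE => /esym/qprojP /asboolP /diff_ideal1 [g [v E]].
have := extd_quintic_primitive.
rewrite -[quintic_primitive](subrK (extd (qrepr g0))) E.
(* [d (v.1 dx + v.2 dy)] is the divergence of the field [(v.2, - v.1)]. *)
move=> H; apply: (@quintic_not_divergence R v.2 (- v.1)).
rewrite -{1}H (extdD (_ + _) (extd _)) (extdD (extd _)) !extdK addr0 add0r.
by rewrite mulrN linearN.
Qed.

End DeRhamH1.

(** * Components of a subset of the line *)

Section Joined.
Variables (R : realType) (I : set R).

Definition joined (u v : R) :=
  forall t, u <= t <= v \/ v <= t <= u -> I t.

Lemma joined_sym u v : joined u v -> joined v u.
Proof. by move=> h t tuv; apply: h; case: tuv; [right|left]. Qed.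

Lemma joined_trans u v w : joined u v -> joined v w -> joined u w.
Proof.
move=> uv vw t tuw; have [tv|vt] := leP t v.
- by case: tuw => /andP[? ?]; [apply: uv|apply: vw]; [left|right]; lra.
- by case: tuw => /andP[? ?]; [apply: vw|apply: uv]; [left|right]; lra.
Qed.

Lemma joined_refl u : I u -> joined u u.
Proof. by move=> Iu t tu; have -> : t = u by case: tu => /andP[? ?]; lra. Qed.

(** [xget] depends only on the set of points joined to [u], hence picks the
same point for all [u] in one component. *)
Definition base u : R := xget 0 (joined u).

Lemma joined_base u : I u -> joined u (base u).
Proof.
by move=> Iu; apply: (@xgetPex _ 0 (joined u)); exists u; exact: joined_refl.
Qed.

Lemma base_joined u v : joined u v -> base u = base v.
Proof.
move=> uv; rewrite /base; congr xget; apply/seteqP; split=> w.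
  exact/joined_trans/joined_sym.
exact: joined_trans.
Qed.

Lemma joined_convex u v (a b : R) :
  joined u v -> 0 <= a -> 0 <= b -> a + b = 1 -> I (a * u + b * v).
Proof.
move=> uv a0 b0 ab; apply: uv; have -> : a = 1 - b by lra.
have b1 : b <= 1 by lra.
have [uv|vu] := leP u v; [left|right]; apply/andP; split; nra.
Qed.

Lemma joined_path (g : R -> R) r s : continuous g -> (forall r, I (g r)) ->
  joined (g r) (g s).
Proof.
wlog rs : r s / r <= s.
  move=> H cg Ig; have [rs|/ltW sr] := leP r s; first exact: H.
  exact/joined_sym/H.
move=> cg Ig t tgg.
have [||c _ <- //] := @IVT R g r s t rs.
  exact: continuous_subspaceT.
by rewrite ge_min le_max; case: tgg => /andP[-> ->]; rewrite ?orbT.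
Qed.

End Joined.

(** * Continuous real functions *)

Section ContinuousArithmetic.
Variables (R : realType) (T : topologicalType).
Implicit Types f g : T -> R.

Lemma continuous_add f g :
  continuous f -> continuous g -> continuous (fun t => f t + g t).
Proof. by move=> cf cg t; exact: (@cvgD _ _ _ _ _ f g _ _ (cf t) (cg t)). Qed.

Lemma continuous_opp f : continuous f -> continuous (fun t => - f t).
Proof. by move=> cf t; exact: (@cvgN _ _ _ _ _ f _ (cf t)). Qed.

Lemma continuous_mul f g :
  continuous f -> continuous g -> continuous (fun t => f t * g t).
Proof. by move=> cf cg t; exact: (@cvgM _ _ _ _ f g _ _ (cf t) (cg t)). Qed.

Lemma continuous_pair f g :
  continuous f -> continuous g -> continuous (fun t => (f t, g t)).
Proof. by move=> cf cg t; exact: (cvg_pair (cf t) (cg t)). Qed.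

Lemma continuous_root f n x : f x = 0 ->
  {for x, continuous (fun t => f t ^+ n.+1)} -> {for x, continuous f}.
Proof.
move=> f0 cf; have {}cf : f t ^+ n.+1 @[t --> x] --> (0 : R).
  by move: cf; rewrite /prop_for /continuous_at f0 expr0n.
rewrite /prop_for /continuous_at f0.
apply/cvgr0Pnorm_lt => e e0; have en0 : 0 < e ^+ n.+1 by rewrite exprn_gt0.
move/cvgr0Pnorm_lt: cf => /(_ _ en0); apply: filterS => t.
by rewrite normrX ltr_pXn2r // nnegrE ltW.
Qed.

End ContinuousArithmetic.

Section ConeMap.
Variable R : realType.

Definition clamp (r : R) := Num.max 0 (Num.min 1 r).

Lemma clamp_itv r : 0 <= clamp r <= 1.
Proof. by rewrite /clamp le_max lexx ge_max ler01 ge_min lexx. Qed.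

Lemma clamp_id r : 0 <= r <= 1 -> clamp r = r.
Proof. by move=> /andP[r0 r1]; rewrite /clamp min_r // max_r. Qed.

Lemma clamp_continuous : continuous clamp.
Proof.
move=> r; apply: (@continuous_max _ _ (cst 0)); first exact: cst_continuous.
by apply: (@continuous_min _ _ (cst 1)); first exact: cst_continuous.
Qed.

(** At points with [z.1 = 0] the quotient is the default value 0 and has no
limit; boundedness of [g] makes the product tend to 0 all the same. *)
Lemma cone_continuous (g : R -> R) (M : R) :
  continuous g -> (forall r, `|g r| <= M) ->
  continuous (fun z : R * R => z.1 * g (z.2 / z.1)).
Proof.
move=> cg gM [a b]; have [->|a0] := eqVneq a 0; last first.
  apply: cvgM; first exact: cvg_fst.
  apply: (@continuous_comp _ _ _ (fun z : R * R => z.2 / z.1) g);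
    last exact: cg.
  apply: cvgM; first exact: cvg_snd.
  by apply: cvgV => //; exact: cvg_fst.
rewrite /continuous_at /= mul0r; apply: norm_cvg0.
apply: (squeeze_cvgr (f := fun=> 0) (h := fun z : R * R => `|z.1| * M)).
- by near=> z; rewrite normr_ge0 normrM ler_wpM2l.
- exact: cvg_cst.
have E : `|z.1| * M @[z --> (0 : R, b)] --> `|0 : R| * M.
  by apply: cvgM; [apply: cvg_norm; exact: cvg_fst|exact: cvg_cst].
by rewrite normr0 mul0r in E.
Unshelve. all: by end_near.
Qed.

End ConeMap.

(** * Barycentric coordinates *)

Section Barycentric.
Variable R : realType.

Definition bary n (t : std_simplex R n) (i : nat) : R := \val t ord0 (inord i).

Lemma bary_continuous n (i : nat) :
  continuous (fun t : std_simplex R n => bary t i).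
Proof.
move=> t; apply: (@continuous_comp _ _ _ set_val
  (fun r : 'rV[R]_n.+1 => r ord0 (inord i))); first exact: initial_continuous.
exact: coord_continuous.
Qed.

Lemma bary_ge0 n (t : std_simplex R n) i : 0 <= bary t i.
Proof. by have [t0 _] := set_mem (valP t); exact: t0. Qed.

Lemma bary_sum1 (t : std_simplex R 1) : bary t 0 + bary t 1 = 1.
Proof.
have [_] := set_mem (valP t); rewrite !big_ord_recl big_ord0 addr0.
by congr (_ + _ = _); congr (_ _ _); apply: val_inj; rewrite /= inordK.
Qed.

Lemma bary_sum2 (t : std_simplex R 2) : bary t 0 + bary t 1 + bary t 2 = 1.
Proof.
have [_] := set_mem (valP t); rewrite !big_ord_recl big_ord0 addr0 addrA.
by congr (_ + _ + _ = _); congr (_ _ _); apply: val_inj; rewrite /= inordK.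
Qed.

Lemma bary_face n (i : nat) (t : std_simplex R n) j :
  (i < n.+2)%N -> (j < n.+2)%N ->
  bary (face (inord i) t) j =
  if (j < i)%N then bary t j else if j == i then 0 else bary t j.-1.
Proof.
move=> ilt jlt; rewrite /bary mxE; case: unliftP => [k|] /(congr1 val) /=;
  rewrite !inordK // => ->; last by rewrite ltnn eqxx.
rewrite /bump /=; have kE := inord_val k; case: (leqP i k) => ik.
  by rewrite add1n ltnNge leqW // gtn_eqF //= kE.
by rewrite add0n ik kE.
Qed.

Lemma simplex1P (t t' : std_simplex R 1) : bary t 1 = bary t' 1 -> t = t'.
Proof.
move=> E; apply: val_inj; apply/rowP => j.
have E0 : bary t 0 = bary t' 0.
  by have := bary_sum1 t; have := bary_sum1 t'; lra.
by rewrite -[j]inord_val; case: j => [[|[|]]].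
Qed.

Definition edge_row (r : R) : 'rV[R]_2 :=
  \row_j (if j == ord0 then 1 - clamp r else clamp r).

Fact edge_row_simplex r : edge_row r \in std_simplex R 1.
Proof.
have /andP[c0 c1] := clamp_itv r; apply/mem_set; split=> [i|].
  by rewrite mxE; case: ifP => _ //; rewrite subr_ge0.
by rewrite !big_ord_recl big_ord0 addr0 !mxE /= subrK.
Qed.

(** Clamping makes this parametrization of the 1-simplex total, so that paths
become continuous functions on the whole line. *)
Definition edge r : std_simplex R 1 := exist _ (edge_row r) (edge_row_simplex r).

Lemma bary_edge r : bary (edge r) 1 = clamp r.
Proof.
by rewrite /bary mxE ifF //; apply/eqP => /(congr1 val); rewrite /= inordK.
Qed.

Lemma edgeK (t : std_simplex R 1) : edge (bary t 1) = t.
Proof.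
apply: simplex1P; rewrite bary_edge clamp_id //.
have := bary_sum1 t; have := bary_ge0 t 0; have := bary_ge0 t 1.
by lra.
Qed.

Lemma edge_clamp r : edge (clamp r) = edge r.
Proof. by apply: simplex1P; rewrite !bary_edge (clamp_id (clamp_itv r)). Qed.

Lemma edge_continuous : continuous edge.
Proof.
apply: continuous_comp_initial => r U /= [P Pn PU].
have c0 : {for r, continuous (fun s => 1 - clamp s)}.
  by apply: cvgB; [exact: cvg_cst|exact: clamp_continuous].
have c1 := @clamp_continuous R r.
have n0 := Pn ord0 ord0; rewrite mxE eqxx in n0.
have n1 := Pn ord0 (lift ord0 ord0); rewrite mxE in n1.
have {}n0 : \forall s \near r, P ord0 ord0 (1 - clamp s) by exact: c0 n0.
have {}n1 : \forall s \near r, P ord0 (lift ord0 ord0) (clamp s).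
  by exact: c1 n1.
apply: filterS2 n0 n1 => s h0 h1.
apply: PU => a j; rewrite [a]ord1 mxE.
by case: (unliftP ord0 j) => [k ->|->] //; rewrite [k]ord1.
Qed.

Fact vertex_simplex : const_mx 1 \in std_simplex R 0.
Proof. by apply/mem_set; split=> [i|]; rewrite ?big_ord1 mxE. Qed.

Definition vertex : std_simplex R 0 := exist _ (const_mx 1) vertex_simplex.

Lemma vertex_face (i : nat) :
  (i < 2)%N -> face (inord i) vertex = edge (1 - i%:R).
Proof.
move=> i2; apply: simplex1P; rewrite bary_face // bary_edge.
case: i i2 => [|[|//]] _ /=; last by rewrite subrr clamp_id // lexx ler01.
by rewrite subr0 clamp_id ?lexx ?ler01 // /bary mxE.
Qed.

Lemma singular_deltaE (Y : topologicalType) n (phi : singular_cochain R Y n) s :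
  singular_delta phi s =
  \sum_(0 <= i < n.+2) (-1) ^+ i * phi (simplex_face (inord i) s).
Proof.
by rewrite /singular_delta big_mkord; apply: eq_bigr => i _; rewrite inord_val.
Qed.

End Barycentric.

(** * First singular cohomology of a subspace of the line *)

Section LineSubspace.
Variables (R : realType) (Y : topologicalType) (I : set R).
Variables (p : R -> Y) (q : Y -> R).
Hypothesis p_cont : forall t, I t -> {for t, continuous p}.
Hypothesis q_cont : continuous q.
Hypothesis Iq : forall y, I (q y).
Hypothesis qK : cancel q p.

Lemma lift_continuous n (G : std_simplex R n -> R) :
  continuous G -> (forall t, I (G t)) -> continuous (p \o G).
Proof. by move=> cG IG t; apply: continuous_comp; [exact: cG|exact: p_cont]. Qed.

Definition lift_simplex n (G : std_simplex R n -> R) (cG : continuous G)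
  (IG : forall t, I (G t)) : singular_simplex R Y n :=
  mkcts (lift_continuous cG IG).

Definition ray_fun y (t : std_simplex R 1) : R :=
  bary t 0 * base I (q y) + bary t 1 * q y.

Lemma ray_fun_continuous y : continuous (ray_fun y).
Proof.
apply: continuous_add; apply: continuous_mul;
  (exact: bary_continuous || exact: cst_continuous).
Qed.

Lemma ray_fun_in y t : I (ray_fun y t).
Proof.
apply: joined_convex (bary_ge0 _ _) (bary_ge0 _ _) _.
  by apply: joined_sym; apply: joined_base; exact: Iq.
exact: bary_sum1.
Qed.

Definition ray y := lift_simplex (@ray_fun_continuous y) (@ray_fun_in y).

Section Cone.
Variable s : singular_simplex R Y 1.
Let g r := q (s (edge r)).

Let g_cont : continuous g.
Proof.
move=> r; apply: (@continuous_comp _ _ _ (fun r => s (edge r)) q);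
  last exact: q_cont.
by apply: continuous_comp; [exact: edge_continuous|exact: cts_fun].
Qed.

Let base_path r r' : base I (g r) = base I (g r').
Proof. by apply: base_joined; apply: joined_path => // r0; exact: Iq. Qed.

Let g_bounded : exists M, forall r, `|g r| <= M.
Proof.
have : compact (g @` `[0, 1]).
  apply: continuous_compact; first exact: continuous_subspaceT.
  exact: segment_compact.
move=> /compact_bounded [M [_ MP]]; exists (M + 1) => r.
apply: (MP (M + 1)); first by rewrite ltrDl.
by exists (clamp r); rewrite /= ?in_itv ?clamp_itv // /g edge_clamp.
Qed.

(** In the plane of the simplex, the point with coordinates [t] lies on the
segment from vertex 0 to the point of parameter [t2 / (t1 + t2)] of the
opposite edge, where [t1 + t2 = 1 - t0]. *)
Definition cone_fun (t : std_simplex R 2) : R :=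
  bary t 0 * base I (g 0) + (1 - bary t 0) * g (bary t 2 / (1 - bary t 0)).

Lemma cone_fun_continuous : continuous cone_fun.
Proof.
have [M gM] := g_bounded.
apply: continuous_add => [|t].
  by apply: continuous_mul; [exact: bary_continuous|exact: cst_continuous].
apply: (@continuous_comp _ _ _ (fun t => (1 - bary t 0, bary t 2))
  (fun z : R * R => z.1 * g (z.2 / z.1)));
  last exact: (cone_continuous g_cont gM).
apply: (continuous_pair _ (@bary_continuous _ _ _)).
apply: continuous_add; first exact: cst_continuous.
by apply: continuous_opp; exact: bary_continuous.
Qed.

Lemma cone_fun_in t : I (cone_fun t).
Proof.
have := bary_sum2 t; have t0 := bary_ge0 t 0.
have := bary_ge0 t 1; have := bary_ge0 t 2 => t2 t1 E.
apply: joined_convex => //; [|by lra|by lra].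
rewrite (base_path 0 (bary t 2 / (1 - bary t 0))).
by apply: joined_sym; apply: joined_base; exact: Iq.
Qed.

Definition cone := lift_simplex cone_fun_continuous cone_fun_in.

Lemma cone_face0 : simplex_face (inord 0) cone = s.
Proof.
apply/continuousEP => t /=; rewrite /mkcts /= /cone_fun !bary_face //=.
rewrite mul0r add0r subr0 mul1r divr1.
by rewrite /g qK edgeK.
Qed.

Lemma cone_face1 : simplex_face (inord 1) cone = ray (s (edge 1)).
Proof.
apply/continuousEP => t /=; rewrite /mkcts /= /cone_fun /ray_fun !bary_face //=.
have E := bary_sum1 t; have -> : 1 - bary t 0 = bary t 1 by lra.
congr (p (_ + _)); first by congr (_ * _); exact: base_path.
by have [->|t1] := eqVneq (bary t 1) 0; rewrite ?mul0r // divff.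
Qed.

Lemma cone_face2 : simplex_face (inord 2) cone = ray (s (edge 0)).
Proof.
apply/continuousEP => t /=; rewrite /mkcts /= /cone_fun /ray_fun !bary_face //=.
have E := bary_sum1 t; have -> : 1 - bary t 0 = bary t 1 by lra.
by rewrite mul0r.
Qed.

End Cone.

(** The primitive of a cocycle takes at a point its value on the ray ending
there. *)
Lemma singular_H1_eq0 (z : cohomology (singular R Y) 1) : z = 0.
Proof.
rewrite -[z]qreprK -[0](linear0 (qproj _)); apply/qprojP; rewrite subr0.
set c := qrepr z; apply/asboolP => /=.
have cz : singular_delta (val c) = 0 by apply/eqP; exact: (valP c).
exists (fun s0 => val c (ray (s0 (vertex R)))) => //; apply/funext => s.
have := congr1 (fun h => h (cone s)) cz.
rewrite /= !singular_deltaE /index_iota /= !big_cons !big_nil.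
rewrite cone_face0 cone_face1 cone_face2.
rewrite /simplex_face /= !vertex_face // subr0 subrr.
rewrite expr0 expr1 sqrrN expr1n !mul1r !mulN1r !addr0.
change (0 (cone s)) with (0 : R) => E.
by lra.
Qed.

End LineSubspace.

(** * Rational parametrization of the curve *)

Section Curve.
Variable R : realType.
Local Notation f := (quintic R).
Local Notation X := (zero_set f).

Lemma quinticE (z : R * R) : f z = z.1 ^+ 4 + z.2 ^+ 5 + z.2 ^+ 4 * z.1.
Proof. by rewrite /quintic !CinfD CinfM !CinfX. Qed.

Definition curve_point (t : R) : R * R :=
  (t * - (t ^+ 4 / (1 + t)), - (t ^+ 4 / (1 + t))).

Lemma curve_point_in t : curve_point t \in X.
Proof.
apply/mem_set; rewrite /zero_set /= quinticE /curve_point /=.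
(* Division by 0 sends the excluded parameter -1 to the origin. *)
have [->|t1] := eqVneq (1 + t) 0; first by rewrite invr0; ring.
by field.
Qed.

Definition curve (t : R) : X := exist _ (curve_point t) (curve_point_in t).

Lemma curve_continuous t : t != -1 -> {for t, continuous curve}.
Proof.
move=> t1 U [_ [[W oW <-]] /= Wt WU].
suff cp : {for t, continuous curve_point}.
  move: (cp W (open_nbhs_nbhs (conj oW Wt))).
  exact: (@filterS _ (nbhs t) _ (curve_point @^-1` W) (curve @^-1` U)
    (fun r => WU (curve r))).
have c1 : {for t, continuous (fun t : R => - (t ^+ 4 / (1 + t)))}.
  apply: cvgN; apply: cvgM; first exact: exprn_continuous.
  apply: cvgV; first by apply: contra t1 => /eqP ?; apply/eqP; lra.
  by apply: cvgD; [exact: cvg_cst|exact: cvg_id].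
have c0 : {for t, continuous (fun t : R => t * - (t ^+ 4 / (1 + t)))}.
  by apply: cvgM; [exact: cvg_id|exact: c1].
exact: (cvg_pair c0 c1).
Qed.

(** The default value [x / 0 = 0] is the right slope at the origin, which is
the only point of the curve with [y = 0]. *)
Definition slope (z : X) : R := (val z).1 / (val z).2.

Lemma slope_pow4 (z : X) : slope z ^+ 4 = - ((val z).1 + (val z).2).
Proof.
have : f (val z) = 0 by exact: (set_mem (valP z)).
rewrite quinticE /slope; case: (val z) => x y /=; have [->|y0] := eqVneq y 0.
  rewrite !expr0n /= !mulr0n mul0r !addr0 => /eqP; rewrite expf_eq0 /= => /eqP ->.
  by rewrite oppr0 mul0r expr0n.
move=> E.
have -> : - (x + y) = (x ^+ 4 - (x ^+ 4 + y ^+ 5 + y ^+ 4 * x)) / y ^+ 4.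
  by field.
by rewrite E subr0 expr_div_n.
Qed.

Lemma slope_snd (z : X) : slope z * (val z).2 = (val z).1.
Proof.
rewrite /slope; have := slope_pow4 z; rewrite /slope; case: (val z) => x y /=.
have [->|y0 _] := eqVneq y 0; last by rewrite divfK.
by rewrite invr0 !mulr0 expr0n addr0 => /eqP; rewrite eq_sym oppr_eq0 => /eqP.
Qed.

Lemma slope_neqN1 (z : X) : slope z != -1.
Proof.
apply/eqP => E; have := slope_pow4 z; have := slope_snd z; rewrite E.
by lra.
Qed.

Lemma slopeK : cancel slope curve.
Proof.
move=> z; apply: val_inj; change (curve_point (slope z) = val z).
have := slope_pow4 z; have := slope_snd z; have := slope_neqN1 z.
move: (slope z) => t; case: (val z) => x y /= t1 tx; rewrite /curve_point => ->.
have E : - (- (x + y) / (1 + t)) = y.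
  rewrite -tx; field; apply: contra t1 => /eqP ?; apply/eqP; lra.
by rewrite E tx.
Qed.

Lemma slope_continuous : continuous slope.
Proof.
have cv : continuous (set_val : X -> R * R) by exact: initial_continuous.
have c1 : continuous (fun z : X => (val z).1).
  move=> z; apply: (@continuous_comp _ _ _ set_val fst); first exact: cv.
  exact: cvg_fst.
have c2 : continuous (fun z : X => (val z).2).
  move=> z; apply: (@continuous_comp _ _ _ set_val snd); first exact: cv.
  exact: cvg_snd.
move=> z; have [y0|y0] := eqVneq (val z).2 0; last first.
  exact: (@cvgM _ _ _ _ (fun z : X => (val z).1) (fun z : X => (val z).2^-1)
    _ _ (c1 z) (cvgV y0 (c2 z))).
have z0 : slope z = 0 by rewrite /slope y0 invr0 mulr0.
apply: (@continuous_root _ _ _ 3) => //.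
rewrite (_ : (fun z : X => _) = (fun z : X => - ((val z).1 + (val z).2))).
  exact: (continuous_opp (continuous_add c1 c2)).
by apply/funext => w; exact: slope_pow4.
Qed.

Lemma curve_H1_eq0 (z : cohomology (singular R X) 1) : z = 0.
Proof.
apply: (@singular_H1_eq0 R X [set t | t != -1] curve slope).
- exact: curve_continuous.
- exact: slope_continuous.
- exact: slope_neqN1.
- exact: slopeK.
Qed.

End Curve.

Unset Implicit Arguments.

Theorem theoremB7 (R : realType) :
  let f : Cinf R :=
    coordx R ^+ 4 + coordy R ^+ 5 + coordy R ^+ 4 * coordx R in
  ~ (forall k : nat,
       lmod_isomorphic (cohomology (deRham f) k)
                       (cohomology (singular R (zero_set f)) k)).
Proof.
move=> f /(_ 1%N) [h hbij].
have [z /eqP] := deRham_H1_neq0 R; apply; apply: (bij_inj hbij).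
by rewrite [LHS]curve_H1_eq0 [RHS]curve_H1_eq0.
Qed.
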